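(* Let $\beta>1$, $\gamma>0$ and $\top>0$. There exist constants $c_1,c_2,c_3>0$, depending only on $\beta,\gamma,\top$, such that the following holds. Let $X$ be a random variable with $\mathbb{E}[\exp(\gamma|X|^\beta)]<\top<\infty$, and let $\rho:\mathcal{L}\to\mathbb{R}$ be a risk measure of type (T1) with parameters $L>0$ and $\kappa\in(0,1]$. Then, for every $\epsilon>0$ and $n\ge1$, $$\mathbb{P}\left(|\rho_n-\rho(X)|>\epsilon\right)\le c_1\left(\exp\left(-c_2n\left(\tfrac{\epsilon}{L}\right)^{2/\kappa}\right)\mathbf 1\{\epsilon\le L\}+\exp\left(-c_3n\left(\tfrac{\epsilon}{L}\right)^{\beta/\kappa}\right)\mathbf 1\{\epsilon>L\}\right).$$
   Context: $\mathcal{L}$ is the set of CDFs on $\mathbb{R}$. A risk measure is a map $\rho:\mathcal{L}\to\mathbb{R}$; if $X$ has CDF $F$, $\rho(X)$ means $\rho(F)$. A risk measure $\rho$ is of type (T1) with parameters $L>0$, $\kappa\in(0,1]$ if $|\rho(F)-\rho(G)|\le L\,(W_1(F,G))^\kappa$ for all $F,G\in\mathcal{L}$. $W_1$ is the 1-Wasserstein distance: $W_1(F_1,F_2)=\inf\int_{\mathbb{R}^2}|x-y|\,dF(x,y)$ over joint distributions $F$ with marginals $F_1,F_2$; equivalently $W_1(F_1,F_2)=\int_{-\infty}^{\infty}|F_1(s)-F_2(s)|\,ds$. Given i.i.d. samples $X_1,\dots,X_n$ from the distribution of $X$, $F_n(x)=\frac1n\sum_{i=1}^n\mathbf 1\{X_i\le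 x\}$ is the empirical distribution function, and $\rho_n=\rho(F_n)$. *)

(* Defs.v *)
From HB Require Import structures.
From mathcomp Require Import all_boot all_order all_algebra.
From mathcomp Require Import all_classical all_reals all_analysis.

Set Implicit Arguments.
Unset Strict Implicit.
Unset Printing Implicit Defensive.

Import Order.TTheory GRing.Theory Num.Theory.
Import numFieldNormedType.Exports.

Local Open Scope classical_set_scope.
Local Open Scope ring_scope.

(* Nondecreasing right-continuous functions with limits 0 at -oo and 1 at +oo. *)
Notation CDF R := (@cumulativeBounded R 0 1).

Section cdf_of_random_variable.
Context d (T : measurableType d) (R : realType) (P : probability T R).
Variable X : {RV P >-> R}.

(* The library's [cdf X] is [\bar R]-valued. *)
Definition rcdf (r : R) : R := fine (cdf X r).

Let rcdf_nd : nondecreasing rcdf.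
Proof. by move=> *; rewrite fine_le ?fin_num_measure// cdf_nondecreasing. Qed.

Let rcdf_rc : right_continuous rcdf.
Proof.
move=> a; apply: fine_cvg.
by rewrite fineK ?fin_num_measure//; exact: cdf_right_continuous.
Qed.

HB.instance Definition _ := isCumulative.Build R _ R rcdf rcdf_nd rcdf_rc.

Let rcdf_Ny0 : rcdf @ -oo --> (0 : R).
Proof. exact/fine_cvg/cvg_cdfNy0. Qed.

Let rcdf_y1 : rcdf @ +oo --> (1 : R).
Proof. exact/fine_cvg/cvg_cdfy1. Qed.

HB.instance Definition _ :=
  isCumulativeBounded.Build R 0 1 rcdf rcdf_Ny0 rcdf_y1.

End cdf_of_random_variable.

(* The proof that [n] is positive is not used in the formula: it is an argument
   so that [ecdf n_gt0 x] can be declared a CDF. *)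
Definition ecdf (R : realType) (n : nat) (n_gt0 : (0 < n)%N) (x : 'I_n -> R)
    (r : R) : R :=
  n%:R^-1 * \sum_(i < n) (x i <= r)%R%:R.

Section empirical_cdf.
Context (R : realType) (n : nat) (n_gt0 : (0 < n)%N) (x : 'I_n -> R).

Local Notation ecdf := (ecdf n_gt0 x).

Let ecdf_nd : nondecreasing ecdf.
Proof.
move=> r s rs; rewrite /ecdf ler_wpM2l ?invr_ge0//; apply: ler_sum => i _.
by rewrite ler_nat; case: (leP (x i) r) => // /le_trans ->.
Qed.

Let ecdf_cvg (F : set_system R) (l : R) (b : 'I_n -> bool) : Filter F ->
  (forall i, \forall r \near F, (x i <= r) = b i) ->
  n%:R^-1 * (\sum_(i < n) (b i)%:R) = l -> ecdf r @[r --> F] --> l.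
Proof.
move=> FF h <-; apply: cvg_near_cst.
have : \forall r \near F, forall i, i \in 'I_n -> (x i <= r) = b i.
  by apply: filter_forall => i; apply: filterS (h i) => r ->.
by apply: filterS => r hr; rewrite /ecdf; congr (_ * _); apply: eq_bigr => i _;
  rewrite hr.
Qed.

Let ecdf_rc : right_continuous ecdf.
Proof.
move=> a; apply: (ecdf_cvg (b := fun i => x i <= a)) => // i.
case: (leP (x i) a) => xa.
  near=> r; apply/(le_trans xa)/ltW; near: r; exact: nbhs_right_gt.
near=> r; apply/negbTE; rewrite -ltNge; near: r; exact: nbhs_right_lt.
Unshelve. all: by end_near. Qed.

HB.instance Definition _ := isCumulative.Build R _ R ecdf ecdf_nd ecdf_rc.

Let ecdf_Ny0 : ecdf @ -oo --> (0 : R).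
Proof.
apply: (ecdf_cvg (b := fun=> false)) => [i|]; last by rewrite big1 ?mulr0.
near=> r; apply/negbTE; rewrite -ltNge; near: r; apply: nbhs_ninfty_lt; exact: num_real.
Unshelve. all: by end_near. Qed.

Let ecdf_y1 : ecdf @ +oo --> (1 : R).
Proof.
apply: (ecdf_cvg (b := fun=> true)) => [i|].
  near=> r; near: r; apply: nbhs_pinfty_ge; exact: num_real.
by rewrite sumr_const card_ord mulVf// pnatr_eq0 -lt0n.
Unshelve. all: by end_near. Qed.

HB.instance Definition _ :=
  isCumulativeBounded.Build R 0 1 ecdf ecdf_Ny0 ecdf_y1.

End empirical_cdf.

Section wasserstein.
Context (R : realType).

Definition is_coupling (F G : CDF R)
    (mu : probability (measurableTypeR R * measurableTypeR R)%type R) : Prop :=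
  (forall x : R, mu (`]-oo, x] `*` [set: R]) = (F x)%:E) /\
  (forall y : R, mu ([set: R] `*` `]-oo, y]) = (G y)%:E).

Definition W1 (F G : CDF R) : \bar R :=
  ereal_inf [set (\int[mu]_z `|(z.1 : R) - (z.2 : R)|%:E)%E |
             mu in is_coupling F G].

(* If [W1 F G] is infinite, then so is the right-hand side of the inequality,
   which then does not restrict [rho]. *)
Definition type_T1 (rho : CDF R -> R) (L kappa : R) : Prop :=
  [/\ 0 < L, 0 < kappa <= 1 &
    forall F G : CDF R,
      ((`|rho F - rho G|%R)%:E <= L%:E * W1 F G `^ kappa)%E].

End wasserstein.

Section iid.
Context d (T : measurableType d) (R : realType) (P : probability T R).

Definition independent_RVs (n : nat) (X : 'I_n -> {RV P >-> R}) : Prop :=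
  forall (J : {set 'I_n}) (A : 'I_n -> set (measurableTypeR R)),
    (forall i, measurable (A i)) ->
    P (\bigcap_(i in [set` J]) (X i @^-1` A i)) =
    (\prod_(i in J) P (X i @^-1` A i))%E.

Definition same_law (X Y : {RV P >-> R}) : Prop :=
  forall A : set (measurableTypeR R), measurable A ->
    distribution P X A = distribution P Y A.

Definition iid_samples (X : {RV P >-> R}) (n : nat)
    (Xs : 'I_n -> {RV P >-> R}) : Prop :=
  independent_RVs Xs /\ forall i, same_law (Xs i) X.

End iid.

(* Main.v *)
Require Import Defs.
From HB Require Import structures.
From mathcomp Require Import all_boot all_order all_algebra.
From mathcomp Require Import all_classical all_reals all_analysis.
From mathcomp Require Import measurable_realfun.
From mathcomp Require Import ring lra.

Import Order.TTheory GRing.Theory Num.Theory.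
Import numFieldNormedType.Exports.

(** [W1 F G] is at most the area between [F] and [G] (quantile coupling), so
    [eps < |rho_n - rho(X)|] forces this area to be at least
    [x = (eps/L)^(1/kappa)]. With [v(s) = (1 + |s|)^beta], the exponential
    moment makes the centered Bernoulli variable [1{X <= s} - F(s)] have
    variance so small compared with [v(s)] that
    [E exp(n t v(s) |F_n(s) - F(s)|) <= 2 exp(n C t^2)], uniformly in [s]
    and for small [t]. Since [1/v] is integrable, Jensen's inequality for
    the measure [ds/v(s)], Markov's inequality and Tonelli's theorem bound the
    probability that the area outside [[-r, r]] is at least [y]. For [x <= 1]
    take [r = 0], [y = x] and [t] proportional to [x]. For [x > 1] take
    [r = x/4], [y = x/2] and [t] constant: inside [[-r, r]] the area is
    at most [2r], and the mass of [1/v] outside decays like [x^(1 - beta)],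
    which turns [x] into [x^beta] in the exponent. *)

Local Open Scope classical_set_scope.
Local Open Scope ring_scope.

Lemma measurable_natr_bool d (T : measurableType d) (R : realType) (D : set T)
    (b : T -> bool) : measurable_fun D b -> measurable_fun D (fun x => (b x)%:R : R).
Proof.
move=> mb mD.
rewrite (_ : (fun x => _) = (fun x => if b x then 1 else 0 : R)).
  by move: (mD); apply: measurable_fun_if => //.
by apply/funext => x; case: (b x).
Qed.

(** * The quantile coupling and the area between two CDFs *)

Section wasserstein_quantile.
Context {R : realType}.
Implicit Types (F G : CDF R) (a b p q s u : R).
Local Notation leb := (@lebesgue_measure R).

(** The integrand is the indicator of the interval between the two points. Read from right to left,
    this turns a transport cost into an area, and a shift of samples into a change of the empirical
    CDF. *)
Lemma integral_abs_sub_indic_le a b :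
  (\int[leb]_s (`|(a <= s)%R%:R - (b <= s)%R%:R|)%:E = `|a - b|%:E)%E.
Proof.
wlog ab : a b / a <= b.
  move=> H; case: (leP a b) => [/H //|/ltW ba].
  by rewrite distrC -H//; apply: eq_integral => s _; rewrite distrC.
transitivity (\int[leb]_s (\1_(`[a, b[%classic : set R) s)%:E)%E.
  apply: eq_integral => s _; rewrite indicE; congr EFin; rewrite mem_setE in_itv/=.
  have [as_|sa] := leP a s; have [bs|sb] := leP b s; rewrite ?subrr ?normr0 ?subr0 ?normr1//.
  by have := le_lt_trans (le_trans ab bs) sa; rewrite ltxx.
rewrite integral_indic// setIT /= lebesgue_measure_itv/= lte_fin.
case: ltgtP ab => // [ab _|-> _]; last by rewrite subrr normr0.
by rewrite distrC gtr0_norm ?subr_gt0// EFinB.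
Qed.

Local Notation U := (uniform_prob (@ltr01 R)).

(** Passing to the open interval drops the endpoints, where [quantile] takes its default value. *)
Lemma uniform01_integral (f : _ -> \bar R) :
  measurable_fun setT f -> (forall x, 0 <= f x)%E ->
  (\int[U]_x f x = \int[leb]_(x in `]0%R, 1%R[) f x)%E.
Proof.
move=> mf f0; rewrite integral_uniform// subr0 invr1 mul1e.
by rewrite -(integral_itv_bndoo true false)//; exact: measurable_funTS.
Qed.

Lemma integral_uniform01_abs_sub p q : 0 <= p <= 1 -> 0 <= q <= 1 ->
  (\int[U]_u (`|(u <= p)%R%:R - (u <= q)%R%:R|)%:E = `|p - q|%:E)%E.
Proof.
wlog pq : p q / p <= q.
  move=> H p01 q01; case: (leP p q) => [/H -> //|/ltW ba].
  by rewrite distrC -H//; apply: eq_integral => s _; rewrite distrC.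
move=> /andP[p0 p1] /andP[q0 q1].
transitivity (\int[U]_s (\1_(`]p, q]%classic : set R) s)%:E)%E.
  apply: eq_integral => s _; rewrite indicE; congr EFin; rewrite mem_setE in_itv/=.
  have [sp|ps] := leP s p; have [sq|qs] := leP s q;
    rewrite ?subrr ?normr0 ?subr0 ?sub0r ?normrN ?normr1//.
  by have := le_lt_trans (le_trans sp pq) qs; rewrite ltxx.
rewrite integral_uniform//=; last exact/measurable_EFinP/measurable_indic.
rewrite subr0 invr1 mul1e integral_indic//= setIidl; last first.
  move=> x/=; rewrite !in_itv/= => /andP[px xq].
  by rewrite (le_trans p0 (ltW px)) (le_trans xq).
rewrite lebesgue_measure_itv/= lte_fin.
case: ltgtP pq => // [ab _|-> _]; last by rewrite subrr normr0.
by rewrite distrC gtr0_norm ?subr_gt0// EFinB.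
Qed.

Lemma CDF_itv01 F s : 0 <= F s <= 1.
Proof.
apply/andP; split.
  rewrite leNgt; apply/negP => Fs0.
  have : \forall t \near -oo, F s < F t by apply: cvgr_gt Fs0; exact: cumulativeNy.
  move=> H; near (@ninfty_nbhs R) => t.
  have : F s < F t by near: t.
  rewrite ltNge => /negP; apply; apply: cumulative_is_nondecreasing.
  by near: t; apply: nbhs_ninfty_le; exact: num_real.
rewrite leNgt; apply/negP => Fs1.
have : \forall t \near +oo, F t < F s by apply: cvgr_lt Fs1; exact: cumulativey.
move=> H; near (@pinfty_nbhs R) => t.
have : F t < F s by near: t.
rewrite ltNge => /negP; apply; apply: cumulative_is_nondecreasing.
by near: t; apply: nbhs_pinfty_ge; exact: num_real.
Unshelve. all: by end_near. Qed.

(** The generalized inverse of [F]. Outside []0, 1[] the set can be empty or unbounded below, hence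
    the default [0], on a null set for the uniform law. *)
Definition quantile F u : R :=
  if 0 < u < 1 then inf [set s | u <= F s] else 0.

(** Right-continuity of [F] makes the infimum attained, which yields this Galois connection. All
    later facts about [quantile] come from it. *)
Lemma quantile_le F u s : 0 < u < 1 -> (quantile F u <= s) = (u <= F s).
Proof.
move=> u01; rewrite /quantile u01; case/andP: u01 => u0 u1.
have lbF : has_lbound [set s | u <= F s].
  have H : \forall t \near -oo, F t < u by apply: cvgr_lt u0; exact: cumulativeNy.
  near (@ninfty_nbhs R) => t.
  exists t => r /= ur; rewrite leNgt; apply/negP => rt.
  have : F t < u by near: t.
  by rewrite ltNge (le_trans ur)//; apply: cumulative_is_nondecreasing; exact: ltW.
have F0 : [set s | u <= F s] !=set0.
  have H : \forall t \near +oo, u < F t by apply: cvgr_gt u1; exact: cumulativey.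
  near (@pinfty_nbhs R) => t.
  by exists t => /=; apply/ltW; near: t.
apply/idP/idP => [|us]; last exact: ge_inf.
move=> infs.
(* The set has points arbitrarily close to its infimum, so each [t > s] lies above one of them;
   right-continuity then carries the inequality down to [s]. *)
have Fus t : s < t -> u <= F t.
  move=> st.
  have := @inf_adherent _ _ (t - s) _ (conj F0 lbF).
  rewrite subr_gt0 => /(_ st)[r /= ur rt].
  apply: (le_trans ur); apply: cumulative_is_nondecreasing; lra.
rewrite leNgt; apply/negP => Fsu.
have H : \forall t \near s^'+, F t < u.
  by apply: cvgr_lt Fsu; exact: cumulative_is_right_continuous.
near s^'+ => t.
have : F t < u by near: t.
by rewrite ltNge Fus//; near: t; exact: nbhs_right_gt.
Unshelve. all: by end_near. Qed.

Lemma measurable_quantile F : measurable_fun [set: R] (quantile F).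
Proof.
rewrite /quantile; apply: measurable_fun_if => //.
  by apply: measurable_and => //; exact: measurable_fun_ltr.
rewrite setTI; set D := (X in measurable_fun X).
have DE : D = `]0%R, 1%R[%classic.
  by apply/seteqP; split => x; rewrite /D/= in_itv.
rewrite DE; apply: (measurability (@RGenOInfty.G R)) => [|/= _ [_] [r] -> <-].
  exact: RGenOInfty.measurableE.
have -> : `]0%R, 1%R[%classic `&`
    (fun u => inf [set s | u <= F s]) @^-1` `]r, +oo[%classic =
    `]0%R, 1%R[%classic `&` `]F r, +oo[%classic.
  apply/seteqP; split => u /= [u01]; rewrite !in_itv/= !andbT => H; split=> //.
    by rewrite ltNge -quantile_le// -ltNge /quantile; rewrite in_itv/= in u01; rewrite u01.
  rewrite in_itv/= in u01.
  by move: H; rewrite ltNge -quantile_le// -ltNge /quantile u01.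
exact: measurableI.
Qed.

Definition W1_area F G : \bar R := (\int[leb]_s (`|F s - G s|)%:E)%E.

Lemma measurable_CDF F : measurable_fun [set: R] F.
Proof. by apply: nondecreasing_measurable => //; exact: cumulative_is_nondecreasing. Qed.

Definition quantile_pair F G (u : measurableTypeR R) : measurableTypeR R * measurableTypeR R :=
  (quantile F u, quantile G u).

Lemma measurable_quantile_pair F G : measurable_fun [set: measurableTypeR R] (quantile_pair F G).
Proof. by apply: measurable_fun_pair; exact: measurable_quantile. Qed.

HB.instance Definition _ F G :=
  isMeasurableFun.Build _ _ _ _ (quantile_pair F G) (measurable_quantile_pair F G).

Let uniform_quantile F s : (U (quantile F @^-1` `]-oo, s]) = (F s)%:E)%E.
Proof.
have mQ : measurable (quantile F @^-1` `]-oo, s]).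
  by rewrite -[X in measurable X]setTI; exact: measurable_quantile.
have /andP[Fs0 Fs1] := CDF_itv01 F s.
rewrite -[X in U X]setIT -integral_indic// uniform01_integral//=; last first.
  exact/measurable_EFinP/measurable_indic.
(* The second level is [0] because its indicator vanishes on []0, 1[]; only the mass of [u <= F s]
   remains. *)
have := @integral_uniform01_abs_sub (F s) 0.
rewrite Fs0 Fs1 lexx ler01 subr0 ger0_norm// => /(_ isT isT) <-.
rewrite uniform01_integral//=; last first.
  apply/measurable_EFinP; apply: measurableT_comp => //.
  by apply: measurable_funB; apply: measurable_natr_bool; exact: measurable_fun_ler.
apply: eq_integral => u; rewrite inE/= in_itv/= => u01.
rewrite indicE; have -> : (u \in quantile F @^-1` `]-oo, s]) = (u <= F s).
  by rewrite -quantile_le//; apply/idP/idP; rewrite inE/= in_itv.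
case/andP: u01 => u0 _.
by rewrite (leNgt u 0) u0 subr0 normr_nat.
Qed.

(** The law of the two quantiles at one common uniform variable is a coupling. Its cost is the area:
    write the distance as an integral of step functions over [s], exchange the integrals, and apply
    [quantile_le] at each [s]. *)
Lemma W1_le_area F G : (W1 F G <= W1_area F G)%E.
Proof.
pose mu : probability (measurableTypeR R * measurableTypeR R)%type R :=
  distribution U (quantile_pair F G).
rewrite /W1 /=; apply: (@le_trans _ _ (\int[mu]_z `|(z.1 : R) - (z.2 : R)|%:E)%E).
  apply: ereal_inf_lbound => /=.
  exists mu => //; split => x.
    rewrite -uniform_quantile; congr (U _).
    by apply/seteqP; split => u /=; [case|].
  rewrite -uniform_quantile; congr (U _).
  by apply/seteqP; split => u /=; [case|].
rewrite ge0_integral_distribution//=; last first.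
  by apply/measurable_EFinP; apply: measurableT_comp => //; exact: measurable_funB.
under eq_integral do rewrite -integral_abs_sub_indic_le.
rewrite (@fubini_tonelli _ _ _ _ _ U leb (fun z : measurableTypeR R * measurableTypeR R =>
  (`|(quantile F z.1 <= z.2)%R%:R - (quantile G z.1 <= z.2)%R%:R|)%:E))//=; last first.
  apply/measurable_EFinP; apply: measurableT_comp => //.
  by apply: measurable_funB; apply: measurable_natr_bool; apply: measurable_fun_ler => //;
    apply: measurableT_comp => //; exact: measurable_quantile.
rewrite /W1_area le_eqVlt; apply/orP; left; apply/eqP.
apply: eq_integral => s _.
rewrite -(integral_uniform01_abs_sub _ _ (CDF_itv01 F s) (CDF_itv01 G s)).
rewrite !uniform01_integral//=.
- apply: eq_integral => u; rewrite inE/= in_itv/= => u01.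
  by rewrite !quantile_le.
- apply/measurable_EFinP; apply: measurableT_comp => //.
  by apply: measurable_funB; apply: measurable_natr_bool; apply: measurable_fun_ler => //;
    exact: measurable_quantile.
- apply/measurable_EFinP; apply: measurableT_comp => //.
  by apply: measurable_funB; apply: measurable_natr_bool; exact: measurable_fun_ler.
Qed.
End wasserstein_quantile.

(** By contraposition: a smaller area bounds [W1] by [(eps / L)^(1 / kappa)], and the Hölder
    condition then bounds the deviation by [eps]. *)
Lemma T1_deviation_area_le {R : realType} (rho : CDF R -> R) (L kappa eps : R)
    (F G : CDF R) : type_T1 rho L kappa -> 0 < eps ->
  eps < `|rho F - rho G| ->
  (((eps / L) `^ kappa^-1)%:E <= W1_area F G)%E.
Proof.
move=> [L0 /andP[k0 _] H] e0 he.
have A0 : (0 <= W1_area F G)%E by apply: integral_ge0.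
rewrite leNgt; apply/negP => hA.
suff : (eps%:E < eps%:E)%E by rewrite ltxx.
apply: (@lt_le_trans _ _ (`|rho F - rho G|%:E)%E); first by rewrite lte_fin.
apply: (le_trans (H F G)).
apply: (@le_trans _ _ (L%:E * ((eps / L) `^ kappa^-1)%:E `^ kappa)%E).
  rewrite lee_pmul2l ?lte_fin//; apply: gt0_ler_poweR; first exact: ltW.
  - rewrite in_itv/= leey andbT.
    by apply: le_ereal_inf_tmp => _ [mu _ <-]; apply: integral_ge0.
  - by rewrite in_itv/= leey andbT lee_fin powR_ge0.
  - exact: (le_trans (W1_le_area _ _) (ltW hA)).
rewrite poweR_EFin -powRrM mulVf ?gt_eqF// powRr1; last by rewrite divr_ge0 // ltW.
by rewrite -EFinM lee_fin mulrC divfK ?gt_eqF.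
Qed.

(** * Measurability of the deviation event *)

Section measurability.
Context {R : realType}.
Implicit Types (n : nat).
Local Notation leb := (@lebesgue_measure R).

Lemma W1_area_ecdf n (n_gt0 : (0 < n)%N) (x y : 'I_n -> R) :
  (W1_area (ecdf n_gt0 x) (ecdf n_gt0 y) <=
   (n%:R^-1 * \sum_(i < n) `|x i - y i|)%:E)%E.
Proof.
have mb (a b : R) : measurable_fun setT (fun s : R => (`|(a <= s)%R%:R - (b <= s)%R%:R|)%:E : \bar R).
  apply/measurable_EFinP; apply: measurableT_comp => //.
  by apply: measurable_funB; apply: measurable_natr_bool; exact: measurable_fun_ler.
rewrite EFinM -sumEFin.
under eq_bigr do rewrite -integral_abs_sub_indic_le.
rewrite -ge0_integral_sum//; last by move=> i; exact: mb.
rewrite -ge0_integralZl//=; last 2 first.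
- by apply: emeasurable_sum => i; exact: mb.
- by move=> s _; apply: sume_ge0.
apply: ge0_le_integral => //=.
- apply/measurable_EFinP; apply: measurableT_comp => //.
  by apply: measurable_funB; exact: measurable_CDF.
- by apply: measurable_funeM; apply: emeasurable_sum => i; exact: mb.
- move=> s _; rewrite sumEFin -EFinM lee_fin /ecdf -mulrBr normrM ger0_norm ?invr_ge0//.
  by rewrite ler_wpM2l ?invr_ge0// -sumrB ler_norm_sum.
Qed.

(** Moving every sample by less than [a / 2] changes the area by at most [a / 2], whereas a
    deviation above [e / 2] would force an area of at least [a]. *)
Lemma T1_ecdf_continuous (rho : CDF R -> R) (L kappa : R) n (n_gt0 : (0 < n)%N) :
  type_T1 rho L kappa ->
  forall e, 0 < e -> exists2 del : R, 0 < del & forall x y : 'I_n -> R,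
    (forall i, `|x i - y i| < del) ->
    `|rho (ecdf n_gt0 x) - rho (ecdf n_gt0 y)| < e.
Proof.
move=> T1 e e0; have [L0 _ _] := T1.
have e2 : 0 < e / 2 by rewrite divr_gt0.
set a := (e / 2 / L) `^ kappa^-1.
have a0 : 0 < a by rewrite powR_gt0// divr_gt0.
exists (a / 2); first by rewrite divr_gt0.
move=> x y xy; apply: le_lt_trans (_ : e / 2 < e); last lra.
rewrite leNgt; apply/negP => /(T1_deviation_area_le _ _ _ _ _ _ T1 e2).
move=> /le_trans/(_ (W1_area_ecdf _ _ _ _)).
rewrite lee_fin -/a leNgt => /negP; apply.
rewrite ltr_pdivrMl ?ltr0n//.
apply: le_lt_trans (ler_sum _ (fun i _ => ltW (xy i))) _.
rewrite sumr_const card_ord -(mulr_natl (a / 2)) ltr_pM2l ?ltr0n//; lra.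
Qed.

(** A strict superlevel set of a continuous function is open, hence a countable union of boxes with
    rational centers, and each box has a measurable preimage. *)
Lemma measurable_comp_continuous d (T : measurableType d) n (X : 'I_n -> {mfun T >-> R})
    (phi : ('I_n -> R) -> R) (c : R) :
  (forall e, 0 < e -> exists2 del : R, 0 < del & forall x y : 'I_n -> R,
    (forall i, `|x i - y i| < del) -> `|phi x - phi y| < e) ->
  measurable [set w | c < phi (fun i => X i w)].
Proof.
move=> phiC.
(* A pair [p] encodes a box by its center and its radius [1 / (p.2 + 1)]; [S p] selects the boxes
   inside the superlevel set. *)
pose S (p : {ffun 'I_n -> rat} * nat) := forall x : 'I_n -> R,
  (forall i, `|x i - ratr (p.1 i)| < p.2.+1%:R^-1) -> c < phi x.
pose B (p : {ffun 'I_n -> rat} * nat) :=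
  [set w | forall i, `|X i w - ratr (p.1 i)| < p.2.+1%:R^-1].
have -> : [set w | c < phi (fun i => X i w)] =
    \bigcup_p (if `[< S p >] then B p else set0).
  apply/seteqP; split => [w /= cw|w [p _]]; last first.
    by case: asboolP => // Sp Bp; apply: Sp.
  have [] := phiC (phi (fun i => X i w) - c); first by rewrite subr_gt0.
  move=> del del0 Hdel.
  (* With radius below [del / 2], a box whose rational center is that close to the samples stays
     within [del] of them. *)
  have [k hk] : exists k, k.+1%:R^-1 < del / 2.
    have [] := near_infty_natSinv_lt (PosNum (divr_gt0 del0 (ltr0Sn R 1))).
    by move=> k _ /(_ k (leqnn k)) H; exists k.
  have ex i : exists q : rat, `|X i w - ratr q| < k.+1%:R^-1.
    have : X i w - k.+1%:R^-1 < X i w + k.+1%:R^-1.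
      by rewrite ltrBlDr -addrA ltrDl addr_gt0// invr_gt0.
    move=> /rat_in_itvoo[q]; rewrite in_itv/= => /andP[q1 q2]; exists q.
    by rewrite ltr_distlC q1 q2.
  exists (finfun (fun i => projT1 (cid (ex i))), k) => //.
  rewrite asboolT.
    move=> i /=; rewrite ffunE; by case: cid.
  move=> x /= Hx; suff : `|phi (fun i => X i w) - phi x| < phi (fun i => X i w) - c.
    by rewrite ltr_norml => /andP[_]; lra.
  apply: Hdel => i.
  move: (Hx i); rewrite ffunE; case: cid => q /= h1 h2.
  by rewrite -(subrKA (ratr q)) (le_lt_trans (ler_normD _ _))// (distrC (ratr q)); move: h1 h2 hk; move: (k.+1%:R^-1) => kk; lra.
apply: countable_bigcupT_measurable => // p; case: ifP => // _.
have -> : B p = \bigcap_(i in [set: 'I_n]) [set w | `|X i w - ratr (p.1 i)| < p.2.+1%:R^-1].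
  by apply/seteqP; split => w /= H i; [move=> _|]; apply: H.
apply: fin_bigcap_measurable => // i _.
rewrite (_ : [set w | _] = (fun w => `|X i w - ratr (p.1 i)|) @^-1` `]-oo, p.2.+1%:R^-1[%classic).
  rewrite -[X in measurable X]setTI.
  suff : measurable_fun setT (fun w => `|X i w - ratr (p.1 i)|) by apply.
  by apply: measurableT_comp => //; exact: measurable_funB.
by apply/seteqP; split => w /=; rewrite in_itv.
Qed.

Lemma measurable_T1_deviation d (T : measurableType d) (rho : CDF R -> R) (L kappa c e : R)
    n (n_gt0 : (0 < n)%N) (X : 'I_n -> {mfun T >-> R}) :
  type_T1 rho L kappa ->
  measurable [set w | e < `|rho (ecdf n_gt0 (fun i => X i w)) - c|].
Proof.
move=> T1; apply: (@measurable_comp_continuous _ _ _ X (fun x => `|rho (ecdf n_gt0 x) - c|)).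
move=> u u0; have [del del0 H] := T1_ecdf_continuous _ _ _ _ n_gt0 T1 _ u0.
exists del => // x y /H; apply: le_lt_trans.
apply: (le_trans (ler_dist_dist _ _)).
by rewrite opprB addrA subrK.
Qed.
End measurability.

(** * The polynomial weight and the integral of its inverse *)

Section polynomial_weight.
Context {R : realType}.
Local Notation leb := (@lebesgue_measure R).
Variable b : R.
Hypothesis b1 : 1 < b.

Definition weight (s : R) : R := (1 + `|s|) `^ b.

Lemma weight_gt0 s : 0 < weight s.
Proof. by rewrite powR_gt0// ltr_pwDl. Qed.

Lemma measurable_weight : measurable_fun setT weight.
Proof.
apply: (measurableT_comp (measurable_powR b)) => //.
by apply: measurable_funD => //; exact: measurableT_comp.
Qed.

(** The antiderivative of [(1 + s)^(- b)] on [s > -1] that vanishes at [+oo]. *)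
Let F (s : R) : R := - (b - 1)^-1 * (1 + s) `^ (1 - b).

Let is_deriveF (s : R) : -1 < s -> is_derive s 1 F ((1 + s) `^ (- b)).
Proof.
move=> s1; have s10 : 0 < 1 + s by lra.
have d1 : is_derive (1 + s) 1 (fun x : R => x `^ (1 - b)) ((1 - b) * (1 + s) `^ (1 - b - 1)).
  exact: is_derive1_powR.
have d2 : is_derive s 1 (fun x : R => 1 + x) (0 + 1) by apply: is_deriveD.
have d3 := is_derive1_comp d1 d2.
have d4 := @is_deriveZ _ _ _ _ (- (b - 1)^-1) _ _ _ d3.
have -> : (1 + s) `^ (- b) = - (b - 1)^-1 *: ((1 - b) * (1 + s) `^ (1 - b - 1) * (0 + 1)).
  rewrite add0r mulr1 /GRing.scale/= mulrA mulNr -mulrN opprB mulVf ?mul1r; last by rewrite gt_eqF// subr_gt0.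
  by congr (_ `^ _); ring.
by [].
Qed.

Lemma continuous_weightV : continuous (fun s => (weight s)^-1).
Proof.
move=> s; apply: cvgV; first by rewrite gt_eqF// weight_gt0.
rewrite /weight; apply: (@continuous_comp _ _ _ (fun x : R => 1 + `|x|) (fun x : R => x `^ b)).
  by apply: continuousD; [exact: cst_continuous|exact: norm_continuous].
have d : is_derive (1 + `|s|) 1 (fun x : R => x `^ b) (b * (1 + `|s|) `^ (b - 1)).
  by apply: is_derive1_powR; rewrite ltr_pwDl.
by apply: differentiable_continuous; apply/derivable1_diffP; apply: ex_derive.
Qed.

Lemma integral_weightV_right (r : R) : 0 <= r ->
  (\int[leb]_(s in `[r, +oo[) (weight s)^-1%:E =
   ((b - 1)^-1 * (1 + r) `^ (1 - b))%:E)%E.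
Proof.
move=> r0; rewrite (@ge0_continuous_FTC2y _ _ F _ 0)/=.
- by rewrite -EFinB sub0r /F mulNr opprK.
- by move=> s _; rewrite invr_ge0 ltW// weight_gt0.
- by apply: continuous_subspaceT; exact: continuous_weightV.
- rewrite -(mulr0 (- (b - 1)^-1)); apply: cvgMr.
  apply/cvgr0Pnorm_lt => e e0.
  (* This threshold solves [z^(1 - b) = e], so [(1 + s)^(1 - b)] is below [e] once [1 + s] exceeds
     it. *)
  have ep : 0 < e `^ (- (b - 1)^-1) by rewrite powR_gt0.
  near=> s.
  have se : e `^ (- (b - 1)^-1) < 1 + s.
    suff : e `^ (- (b - 1)^-1) < s by move=> es; rewrite (lt_trans es)// ltrDr.
    by near: s; apply: nbhs_pinfty_gt; exact: num_real.
  rewrite ger0_norm ?powR_ge0//.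
  have := @gt0_ltr_powR _ (b - 1) _ (e `^ (- (b - 1)^-1)) (1 + s).
  rewrite subr_gt0 b1 => /(_ isT).
  rewrite !nnegrE (ltW ep) (ltW (lt_trans ep se)) se => /(_ isT isT isT).
  rewrite -powRrM mulNr mulVf; last by rewrite gt_eqF// subr_gt0.
  rewrite powR_inv1 ?(ltW e0)// => h.
  rewrite -opprB powRN invf_plt ?posrE//; last by rewrite powR_gt0// (lt_trans ep).
- move=> s rs; apply: ex_derive; apply: is_deriveF; lra.
- apply: cvg_at_right_filter.
  have d : is_derive r 1 F ((1 + r) `^ (- b)) by apply: is_deriveF; lra.
  by apply: differentiable_continuous; apply/derivable1_diffP; apply: ex_derive.
- move=> s; rewrite in_itv/= andbT => rs; rewrite derive1E.
  have d : is_derive s 1 F ((1 + s) `^ (- b)) by apply: is_deriveF; lra.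
  by rewrite derive_val /weight powRN ger0_norm//; lra.
Unshelve. all: by end_near. Qed.

Lemma integral_weightV_left (r : R) : 0 <= r ->
  (\int[leb]_(s in `]-oo, (- r)%R]) (weight s)^-1%:E =
   ((b - 1)^-1 * (1 + r) `^ (1 - b))%:E)%E.
Proof.
move=> r0; rewrite ge0_integration_by_substitutionNy.
- rewrite -integral_weightV_right//; apply: eq_integral => s _.
  by rewrite /= /weight normrN.
- by apply: continuous_subspaceT; exact: continuous_weightV.
- by move=> s _; rewrite invr_ge0 ltW// weight_gt0.
Qed.

Lemma integral_weightV_out (r : R) : 0 <= r ->
  (\int[leb]_(s in ~` `[(- r)%R, r[) (weight s)^-1%:E =
   (2 * (b - 1)^-1 * (1 + r) `^ (1 - b))%:E)%E.
Proof.
move=> r0.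
have -> : ~` `[- r, r[%classic = `]-oo, - r[%classic `|` `[r, +oo[%classic :> set R.
  apply/seteqP; split => s /=; rewrite !in_itv/= ?andbT.
    by move=> /negP; rewrite negb_and -!real_ltNge ?num_real// -real_leNgt ?num_real// => /orP[]; [left|right].
  by case; rewrite ?andbT => h; apply/negP; rewrite negb_and -!real_ltNge ?num_real// -real_leNgt ?num_real// h ?orbT.
rewrite ge0_integral_setU//=.
- rewrite integral_weightV_right// integral_itv_bndo_bndc; last first.
    apply: measurable_funTS; apply/measurable_EFinP.
    exact: continuous_measurable_fun continuous_weightV.
  by rewrite integral_weightV_left// -EFinD -mulrA mulr_natl mulr2n.
- apply: measurable_funTS; apply/measurable_EFinP.
  exact: continuous_measurable_fun continuous_weightV.
- by move=> s _; rewrite lee_fin invr_ge0 ltW// weight_gt0.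
- apply/disj_setPS => s [] /=; rewrite !in_itv/= andbT => h1 h2.
  have : r < - r by apply: le_lt_trans h1.
  by rewrite ltNge ge0_cp.
Qed.
End polynomial_weight.

(** A quadratic remainder bound for both signs of [m], drawn only from [1 + z <= exp z] at [z = m]
    and [z = - m]. *)
Lemma expR_sub1_sub_le (R : realType) (m : R) :
  expR m - 1 - m <= m ^+ 2 * expR `|m|.
Proof.
have h1 := expR_ge1Dx m; have h2 := expR_ge1Dx (- m).
have e0 := expR_gt0 m.
have h3 : expR m - 1 <= m * expR m.
  have : expR m * (1 - m) <= expR m * expR (- m) by rewrite ler_pM2l.
  by rewrite -expRD subrr expR0; lra.
have [m0|m0] := leP 0 m.
  rewrite ger0_norm// expr2 -mulrA.
  have := ler_wpM2l m0 h3; lra.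
rewrite ltr0_norm//.
have h4 : 1 <= expR (- m) by lra.
have h5 : m * (expR m - 1) <= m * m by rewrite ler_nM2l//; lra.
have h6 : m ^+ 2 * 1 <= m ^+ 2 * expR (- m) by rewrite ler_wpM2l// sqr_ge0.
rewrite expr2 in h6 *; lra.
Qed.

(** Factor out [exp(- m p)], then apply [1 + z <= exp z] and the quadratic remainder bound. Swapping
    success and failure replaces [m] by [- m] and [p] by [1 - p]. The factor [q] in the exponent is
    what lets a small tail probability offset a large [m]. *)
Lemma centered_bernoulli_mgf_le (R : realType) (p q m : R) : 0 <= p <= 1 ->
  q = p \/ q = 1 - p ->
  p * expR (m * (1 - p)) + (1 - p) * expR (- (m * p)) <=
  expR (q * (m ^+ 2 * expR `|m|)).
Proof.
wlog -> : p q m / q = p.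
  move=> H p01 [->|->]; first by apply: H => //; left.
  have -> : p * expR (m * (1 - p)) + (1 - p) * expR (- (m * p)) =
      (1 - p) * expR (- m * (1 - (1 - p))) + (1 - (1 - p)) * expR (- (- m * (1 - p))).
    by rewrite addrC; congr (_ * expR _ + _ * expR _); ring.
  rewrite -normrN -sqrrN; apply: H => //; last by left.
  by case/andP: p01 => p0 p1; apply/andP; split; lra.
move=> /andP[p0 p1] _.
have -> : p * expR (m * (1 - p)) + (1 - p) * expR (- (m * p)) =
          expR (- (m * p)) * (1 + p * (expR m - 1)).
  by rewrite mulrBr mulr1 expRD; ring.
apply: (@le_trans _ _ (expR (- (m * p)) * expR (p * (expR m - 1)))).
  by rewrite ler_pM2l ?expR_gt0// expR_ge1Dx.
rewrite -expRD ler_expR.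
have := ler_wpM2l p0 (expR_sub1_sub_le _ m); lra.
Qed.

(* Integrating the tangent line inequality [exp y >= exp a * (1 + y - a)], with the negative term moved to the left so that all integrands are nonnegative. *)
Lemma jensen_expR d (T : measurableType d) (R : realType)
    (mu : {measure set T -> \bar R}) (h y : T -> R) (M a : R) :
  measurable_fun setT h -> measurable_fun setT y ->
  (forall t, 0 <= h t) -> (forall t, 0 <= y t) -> 0 <= a ->
  (\int[mu]_t (h t)%:E = M%:E)%E ->
  ((a * M)%:E <= \int[mu]_t (h t * y t)%:E)%E ->
  ((M * expR a)%:E <= \int[mu]_t (h t * expR (y t))%:E)%E.
Proof.
move=> mh my h0 y0 a0 hM haM.
have mhe : measurable_fun setT (fun t => (h t * expR (y t))%:E).
  by apply/measurable_EFinP/measurable_funM => //; exact: measurableT_comp.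
have mhy : measurable_fun setT (fun t => (h t * y t)%:E).
  by apply/measurable_EFinP/measurable_funM.
have meh : measurable_fun setT (EFin \o h) by exact/measurable_EFinP.
have ea0 := expR_ge0 a.
suff : ((expR a * (a * M))%:E + (M * expR a)%:E <=
    (expR a * (a * M))%:E + \int[mu]_t (h t * expR (y t))%:E)%E.
  by rewrite leeD2lE.
apply: (@le_trans _ _ (\int[mu]_t ((expR a)%:E * (h t)%:E + (expR a)%:E * (h t * y t)%:E))%E).
  rewrite ge0_integralD//=.
  - rewrite !ge0_integralZl//= ?lee_fin//.
    + rewrite hM addeC -EFinM (mulrC M); apply: leeD => //.
      by rewrite EFinM lee_pmul2l// lte_fin expR_gt0.
    + by move=> t _; rewrite lee_fin mulr_ge0.
    + by move=> t _; rewrite lee_fin.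
  - by move=> t _; rewrite -EFinM lee_fin mulr_ge0.
  - by apply: measurable_funeM.
  - by move=> t _; rewrite -EFinM lee_fin !mulr_ge0.
  - by apply: measurable_funeM.
apply: (@le_trans _ _ (\int[mu]_t ((expR a * a)%:E * (h t)%:E + (h t * expR (y t))%:E))%E).
  apply: ge0_le_integral => //=.
  - by move=> t _; rewrite -!EFinM -EFinD lee_fin addr_ge0// ?mulr_ge0.
  - by apply: emeasurable_funD; apply: measurable_funeM.
  - by apply: emeasurable_funD => //; apply: measurable_funeM.
  - move=> t _; rewrite -!EFinM -!EFinD lee_fin.
    have : h t * (expR a * (1 + (y t - a))) <= h t * expR (y t).
      rewrite ler_wpM2l// -[X in _ <= expR X](subrKC a) expRD ler_pM2l ?expR_gt0//.
      exact: expR_ge1Dx.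
    lra.
rewrite ge0_integralD//=.
- rewrite ge0_integralZl//= ?lee_fin ?mulr_ge0//; last by move=> t _; rewrite lee_fin.
  by rewrite hM -EFinM mulrA.
- by move=> t _; rewrite -EFinM lee_fin !mulr_ge0.
- by apply: measurable_funeM.
- by move=> t _; rewrite lee_fin mulr_ge0// expR_ge0.
Qed.

(** * Exponential moments of the empirical CDF at one point *)

Section independent_samples.
Context d (T : measurableType d) {R : realType} (P : probability T R).

(** Independence speaks of events, so the product is expanded over the sets of indices whose samples
    hit [A]; summing the resulting probabilities gives back the power. *)
Lemma expectation_prod_two_valued n (X : 'I_n -> {RV P >-> R}) (A : set R) (p u v : R) :
  independent_RVs X -> measurable A -> (forall i, P (X i @^-1` A) = p%:E) ->
  0 <= u -> 0 <= v ->
  (\int[P]_w (\prod_(i < n) (if X i w \in A then u else v))%:E =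
   ((p * u + (1 - p) * v) ^+ n)%:E)%E.
Proof.
move=> Xind mA XA u0 v0.
(* [C J] is the event that exactly the samples indexed by [J] fall in [A], and [c J] is the value of
   the product there. *)
pose B (J : {set 'I_n}) i := if i \in J then A else ~` A.
pose C (J : {set 'I_n}) := \bigcap_(i in [set` [set: 'I_n]%SET]) (X i @^-1` B J i).
pose c (J : {set 'I_n}) : R := \prod_i (if i \in J then u else v).
have c0 J : 0 <= c J by apply: prodr_ge0 => i _; case: ifP.
have mB J i : measurable (B J i) by rewrite /B; case: ifP => _ //; exact: measurableC.
have mXB J i : measurable (X i @^-1` B J i).
  by rewrite -[X in measurable X]setTI; exact: (measurable_funPT (X i)).
have mC J : measurable (C J) by apply: fin_bigcap_measurable.
have XAc i : P (X i @^-1` (~` A)) = (1 - p)%:E.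
  rewrite preimage_setC probability_setC ?XA//.
  by rewrite -[X in measurable X]setTI; exact: (measurable_funPT (X i)).
have PC J : P (C J) = (\prod_i (if i \in J then p else 1 - p))%:E.
  rewrite /C Xind; last by move=> i; exact: mB.
  rewrite -prodEFin; apply: eq_big => [i|i _]; first by rewrite inE.
  by rewrite /B; case: ifP => _.
transitivity (\int[P]_w \sum_J (c J)%:E * (\1_(C J) w)%:E)%E.
  apply: eq_integral => w _.
  rewrite (eq_bigr (fun i => u * (X i w \in A)%:R + v * (X i w \notin A)%:R)); last first.
    by move=> i _; case: ifP => _; rewrite /= ?mulr0 ?mulr1 ?addr0 ?add0r.
  rewrite bigA_distr -sumEFin; apply: eq_big => // J _; rewrite -EFinM; congr EFin.
  rewrite (eq_bigr (fun i => (if i \in J then u else v) * (X i w \in B J i)%:R)); last first.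
    by move=> i _; rewrite /B; case: ifP => _ //; rewrite in_setC.
  rewrite big_split/=; congr (_ * _).
  rewrite -natr_prod indicE; congr (_%:R).
  have [wC|wC] := boolP (w \in C J).
    rewrite big1// => i _; rewrite mem_set//.
    by have := set_mem wC i; apply; rewrite /= inE.
  apply/eqP; rewrite -leqn0 leqNgt; apply/negP => /gt0_prodn H.
  move/negP: wC; apply; apply: mem_set => i _ /=.
  by have := H i isT; rewrite lt0b => /set_mem.
rewrite ge0_integral_sum//; last 2 first.
- by move=> J; apply: measurable_funeM; exact/measurable_EFinP/measurable_indic.
- by move=> J w _; rewrite -EFinM lee_fin mulr_ge0.
have intC J : (\int[P]_w ((c J)%:E * (\1_(C J) w)%:E) =
    (\prod_i ((if i \in J then u else v) * (if i \in J then p else 1 - p)))%:E)%E.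
  rewrite ge0_integralZl//; last 2 first.
  - exact/measurable_EFinP/measurable_indic.
  - by rewrite lee_fin.
  rewrite (integral_indic _ measurableT (mC J)) setIT big_split EFinM.
  by congr (_ * _)%E; exact: PC.
rewrite (eq_bigr _ (fun J _ => intC J)).
rewrite sumEFin; congr EFin.
rewrite -[RHS](_ : \prod_(i < n) (p * u + (1 - p) * v) = _); last first.
  by rewrite prodr_const card_ord.
rewrite bigA_distr; apply: eq_bigr => J _; apply: eq_bigr => i _.
by case: ifP => _; rewrite mulrC.
Qed.

(** Since [exp(m |z|) <= exp(m z) + exp(- m z)], two signed moment bounds suffice, whence the factor
    2. Each factors over the samples into centered Bernoulli moments. *)
Lemma mgf_ecdf_deviation n (n_gt0 : (0 < n)%N) (X : 'I_n -> {RV P >-> R})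
    (A : set R) (p q m : R) :
  independent_RVs X -> measurable A -> (forall i, P (X i @^-1` A) = p%:E) ->
  q = p \/ q = 1 - p -> 0 <= m ->
  (\int[P]_w (expR (m * (n%:R * `|n%:R^-1 * \sum_(i < n) (X i w \in A)%:R - p|)))%:E
   <= (2 * expR (n%:R * (q * (m ^+ 2 * expR m))))%:E)%E.
Proof.
move=> Xind mA XA qp m0.
have p01 : 0 <= p <= 1.
  have i := Ordinal n_gt0.
  rewrite -!lee_fin -(XA i); apply/andP; split; [exact: measure_ge0|apply: probability_le1; rewrite -[X in measurable X]setTI; exact: (measurable_funPT (X i))].
have mgf (t : R) : `|t| = m ->
  (\int[P]_w (expR (t * (\sum_(i < n) ((X i w \in A)%:R - p))))%:E
   <= (expR (n%:R * (q * (m ^+ 2 * expR m))))%:E)%E.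
  move=> tm.
  rewrite (eq_integral (fun w => (\prod_(i < n)
    (if X i w \in A then expR (t * (1 - p)) else expR (- (t * p))))%:E)); last first.
    move=> w _; rewrite mulr_sumr (big_morph _ (@expRD R) (@expR0 R)); congr EFin; apply: eq_bigr => i _.
    by case: ifP => _ //=; rewrite sub0r mulrN.
  rewrite (expectation_prod_two_valued _ _ _ p)// ?expR_ge0// lee_fin.
  rewrite expRM_natl lerXn2r// ?nnegrE ?expR_ge0//.
    by case/andP: p01 => p0 p1; rewrite addr_ge0// mulr_ge0// ?expR_ge0// subr_ge0.
  have -> : m ^+ 2 = t ^+ 2 by rewrite -tm real_normK ?num_real.
  by rewrite -[in expR m]tm; exact: centered_bernoulli_mgf_le.
have mxi i : measurable_fun setT (fun w => (X i w \in A)%:R : R).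
  have -> : (fun w => (X i w \in A)%:R) = \1_(X i @^-1` A) :> (T -> R).
    by apply/funext => w; rewrite indicE; congr (_%:R); apply/idP/idP; rewrite !inE.
  apply: measurable_indic.
  by rewrite -[X in measurable X]setTI; exact: (measurable_funPT (X i)).
have msum t : measurable_fun setT
    (fun w => (expR (t * (\sum_(i < n) ((X i w \in A)%:R - p))))%:E).
  apply/measurable_EFinP; apply: measurableT_comp => //.
  apply: measurable_funM => //; apply: measurable_sum => i.
  exact: measurable_funB.
apply: (@le_trans _ _ (\int[P]_w (
   (expR (m * (\sum_(i < n) ((X i w \in A)%:R - p))))%:E +
   (expR (- m * (\sum_(i < n) ((X i w \in A)%:R - p))))%:E))%E).
  apply: ge0_le_integral => //=.
  - apply/measurable_EFinP; apply: measurableT_comp => //.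
    do 2 apply: measurable_funM => //; apply: measurableT_comp => //.
    by apply: measurable_funB => //; apply: measurable_funM => //; exact: measurable_sum.
  - exact: emeasurable_funD.
  - move=> w _; rewrite -EFinD lee_fin sumrB sumr_const card_ord -[p *+ n]mulr_natl.
    set s := \sum_(i < n) _.
    have -> : n%:R * `|n%:R^-1 * s - p| = `|s - n%:R * p|.
      rewrite -{1}[n%:R]ger0_norm// -normrM mulrBr mulrA divff ?mul1r//.
      by rewrite pnatr_eq0 -lt0n.
    have [h|h] := leP 0 (s - n%:R * p).
      by rewrite ger0_norm// lerDl expR_ge0.
    by rewrite ltr0_norm// mulrN mulNr lerDr expR_ge0.
rewrite ge0_integralD//= mulr_natl mulr2n EFinD leeD//; apply: mgf.
- exact: ger0_norm.
- by rewrite normrN ger0_norm.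
Qed.
End independent_samples.

(** * Tail decay against the weight *)

Section tails.
Context d (T : measurableType d) {R : realType} (P : probability T R).
Local Notation leb := (@lebesgue_measure R).
Variables (b gamma top : R).
Hypotheses (b1 : 1 < b) (gamma0 : 0 < gamma) (top0 : 0 < top).

Lemma exp_moment_tail (X : {RV P >-> R}) (s : R) :
  ('E_P[fun w => expR (gamma * `|X w| `^ b)] < top%:E)%E ->
  (P [set w | (`|s| <= `|X w|)%R] <= (top * expR (- (gamma * `|s| `^ b)))%:E)%E.
Proof.
rewrite unlock => HX.
have mX : measurable_fun setT (fun w => `|X w|) by exact: measurableT_comp.
have mA : measurable [set w | `|s| <= `|X w|].
  rewrite (_ : [set w | _] = (fun w => `|X w|) @^-1` `[`|s|, +oo[%classic).
    by rewrite -[X in measurable X]setTI; apply: mX.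
  by apply/seteqP; split => w /=; rewrite in_itv/= andbT.
rewrite expRN EFinM lee_pdivlMr ?expR_gt0// muleC.
apply: le_trans (ltW HX).
rewrite -[X in P X]setIT -(integral_indic _ measurableT mA) -ge0_integralZl//; last first.
  exact/measurable_EFinP/measurable_indic.
apply: ge0_le_integral => //=.
  + by apply: measurable_funeM; exact/measurable_EFinP/measurable_indic.
  + apply/measurable_EFinP; apply: measurableT_comp => //.
    by apply: measurable_funM => //; apply: (@measurableT_comp _ _ _ _ _ _ (fun x : R => x `^ b)) => //; exact: measurable_powR.
  + move=> w _; rewrite indicE -EFinM lee_fin; have [|_] := boolP (w \in _).
      rewrite inE/= => sX; rewrite mulr1 ler_expR ler_pM2l//.
      by apply: ge0_ler_powR; rewrite ?nnegrE// (le_trans _ (ltW b1)).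
    by rewrite mulr0 expR_ge0.
Qed.

Definition rate : R := gamma * 2 `^ (- b).

Lemma rate_gt0 : 0 < rate.
Proof. by rewrite mulr_gt0// powR_gt0. Qed.

(** The factor [top * exp(gamma)] comes from the tail bound rewritten in terms of the weight, and
    [16 / rate^2] from bounding the squared weight by an exponential. *)
Definition mgf_const : R := top * expR gamma * (16 / rate ^+ 2).

Lemma mgf_const_gt0 : 0 < mgf_const.
Proof. by rewrite !mulr_gt0// ?expR_gt0// invr_gt0 exprn_gt0// rate_gt0. Qed.

(** Because [1 + |s| <= 2 max(1, |s|)], the weight is at most [2^b (1 + |s|^b)]; the factor
    [2^(- b)] in [rate] absorbs the [2^b]. *)
Lemma rate_weight_le s : rate * weight b s <= gamma * (1 + `|s| `^ b).
Proof.
rewrite /rate /weight -mulrA ler_pM2l// powRN ler_pdivrMl ?powR_gt0//.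
apply: (@le_trans _ _ ((2 * Num.max 1 `|s|) `^ b)).
  apply: ge0_ler_powR; first exact: le_trans (ltW b1).
  - by rewrite nnegrE addr_ge0.
  - by rewrite nnegrE mulr_ge0// le_max ler01.
  - by have [h|h] := leP 1 `|s|; lra.
rewrite powRM ?le_max ?ler01// ler_pM2l ?powR_gt0//.
have [h|h] := leP 1 `|s|; first by rewrite lerDr.
by rewrite powR1 lerDl powR_ge0.
Qed.

(** With [v] the weight, the tail is at most [top * exp(gamma - rate v)]. One half of the decay
    [rate v] pays for [exp(t v)], the other half for [v^2]. *)
Lemma tail_weight_le (q s t : R) : 0 <= t <= rate / 2 -> 0 <= q ->
  q <= top * expR (- (gamma * `|s| `^ b)) ->
  q * ((t * weight b s) ^+ 2 * expR (t * weight b s)) <= mgf_const * t ^+ 2.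
Proof.
move=> /andP[t0 tr] q0 hq; set v := weight b s.
have v0 : 0 < v by exact: weight_gt0.
have r0 := rate_gt0.
(* Square [z <= exp z] at [z = rate * v / 4]. *)
have v2 : v ^+ 2 <= 16 / rate ^+ 2 * expR (rate * v / 2).
  have h : rate * v / 4 <= expR (rate * v / 4).
    by apply: le_trans (expR_ge1Dx _); lra.
  have h2 : (rate * v / 4) ^+ 2 <= expR (rate * v / 2).
    have -> : expR (rate * v / 2) = expR (rate * v / 4) ^+ 2.
      by rewrite -expRM_natl; congr expR; lra.
    by rewrite lerXn2r// ?nnegrE ?expR_ge0// !mulr_ge0// ltW.
  have -> : v ^+ 2 = 16 / rate ^+ 2 * (rate * v / 4) ^+ 2.
    by field; rewrite gt_eqF.
  by rewrite ler_pM2l// divr_gt0// exprn_gt0.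
apply: (@le_trans _ _ ((top * expR (gamma - rate * v)) * ((t * v) ^+ 2 * expR (rate * v / 2)))).
  apply: ler_pM => //.
  - by rewrite mulr_ge0 ?sqr_ge0 ?expR_ge0.
  - apply: (le_trans hq); rewrite ler_pM2l// ler_expR.
    by have := rate_weight_le s; rewrite -/v; lra.
  - rewrite ler_wpM2l ?sqr_ge0// ler_expR.
    by have := ler_wpM2r (ltW v0) tr; lra.
rewrite /mgf_const expRD.
have e0 := expR_gt0 (- (rate * v)).
have e1 : expR (- (rate * v)) * expR (rate * v / 2) * expR (rate * v / 2) = 1.
  by rewrite -!expRD -[RHS]expR0; congr expR; lra.
have g0 := expR_gt0 gamma.
have k0 : 0 <= top * expR gamma * t ^+ 2 * (expR (- (rate * v)) * expR (rate * v / 2)).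
  by do !apply: mulr_ge0; rewrite ?sqr_ge0 ?expR_ge0// ltW.
have := ler_wpM2l k0 v2.
set E := expR (- (rate * v)) in e1 *; set H := expR (rate * v / 2) in e1 *.
set G := expR gamma.
have -> : top * G * t ^+ 2 * (E * H) * (16 / rate ^+ 2 * H) =
   top * G * (16 / rate ^+ 2) * t ^+ 2 * (E * H * H) by ring.
rewrite e1 mulr1 exprMn; apply: le_trans; rewrite le_eqVlt; apply/orP; left; apply/eqP; ring.
Qed.

Lemma mgf_weighted_deviation (X : {RV P >-> R}) n (n_gt0 : (0 < n)%N)
    (Xs : 'I_n -> {RV P >-> R}) (s t : R) :
  ('E_P[fun w => expR (gamma * `|X w| `^ b)] < top%:E)%E ->
  iid_samples X Xs -> 0 <= t <= rate / 2 ->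
  (\int[P]_w (expR (n%:R * t * weight b s *
     `|ecdf n_gt0 (fun i => Xs i w) s - rcdf X s|))%:E <=
   (2 * expR (n%:R * (mgf_const * t ^+ 2)))%:E)%E.
Proof.
move=> HX [Xind Xlaw] t01.
set p := rcdf X s.
have mXA (Y : {RV P >-> R}) (A : set R) : measurable A -> measurable (Y @^-1` A).
  by move=> mA; rewrite -[X in measurable X]setTI; exact: (measurable_funPT Y).
have pE : P (X @^-1` `]-oo, s]) = p%:E.
  by rewrite /p /rcdf fineK// fin_num_measure//; exact: mXA.
have XsE i : P (Xs i @^-1` `]-oo, s]) = p%:E by rewrite -pE; exact: Xlaw.
have p01 : 0 <= p <= 1 := CDF_itv01 (rcdf X : CDF R) s.
(* The mass on the side of [s] away from the origin: that event lies in [|s| <= |X|], so the tail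
   bound controls [q]. *)
pose q := if 0 <= s then 1 - p else p.
have qp : q = p \/ q = 1 - p by rewrite /q; case: ifP; [right|left].
have q0 : 0 <= q by rewrite /q; case: ifP => _; case/andP: p01 => ? ?; lra.
have hq : q <= top * expR (- (gamma * `|s| `^ b)).
  rewrite -lee_fin; apply: le_trans (exp_moment_tail X s HX).
  have mS : measurable [set w | `|s| <= `|X w|].
    have mX : measurable_fun setT (fun w => `|X w|) by exact: measurableT_comp.
    rewrite (_ : [set w | _] = (fun w => `|X w|) @^-1` `[`|s|, +oo[%classic).
      by rewrite -[X in measurable X]setTI; apply: mX.
    by apply/seteqP; split => w /=; rewrite in_itv/= andbT.
  rewrite /q; case: ifPn => [s0|s0].
    have -> : (1 - p)%:E = P (~` (X @^-1` `]-oo, s])).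
      by rewrite probability_setC ?pE//; exact: mXA.
    apply: le_measure; rewrite ?inE//; first by apply: measurableC; exact: mXA.
    move=> w /=; rewrite in_itv/= => /negP; rewrite -ltNge => sX.
    by rewrite !ger0_norm ?(le_trans s0)// ltW.
  rewrite -pE; apply: le_measure; rewrite ?inE//; first exact: mXA.
  move=> w /=; rewrite in_itv/= => Xs0; rewrite -ltNge in s0.
  by rewrite !ltr0_norm// ?lerN2// (le_lt_trans Xs0).
have v0 := weight_gt0 b s.
case/andP: (t01) => t0 _.
have m0 : 0 <= t * weight b s by rewrite mulr_ge0// ltW.
have := @mgf_ecdf_deviation _ _ _ _ n n_gt0 Xs `]-oo, s]%classic p q (t * weight b s)
  Xind (measurable_itv _) XsE qp m0.
rewrite (eq_integral (fun w => (expR (n%:R * t * weight b s *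
     `|ecdf n_gt0 (fun i => Xs i w) s - rcdf X s|))%:E)); last first.
  move=> w _; congr (expR _)%:E; rewrite -/p mulrA -mulrA mulrCA !mulrA /ecdf; congr (_ * `|_ * _ - _|).
    by apply: eq_bigr => i _; rewrite mem_setE in_itv.
move=> /le_trans; apply; rewrite lee_fin ler_pM2l// ler_expR ler_wpM2l//.
exact: tail_weight_le.
Qed.
End tails.

(** * Tail bounds for the area outside an interval *)

Section area_tail.
Context d (T : measurableType d) {R : realType} (P : probability T R).
Local Notation leb := (@lebesgue_measure R).
Variables (b gamma top : R).
Hypotheses (b1 : 1 < b) (gamma0 : 0 < gamma) (top0 : 0 < top).

(** The integral of the inverse weight outside [[-r, r[]. *)
Definition weight_mass (r : R) : R := 2 * (b - 1)^-1 * (1 + r) `^ (1 - b).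

(** The parameters [r], [t] and [y] stay free so that both regimes of [eps] are instances. *)
Lemma area_tail (X : {RV P >-> R}) n (n_gt0 : (0 < n)%N)
    (Xs : 'I_n -> {RV P >-> R}) (r t y : R) (B : set T) :
  ('E_P[fun w => expR (gamma * `|X w| `^ b)] < top%:E)%E ->
  iid_samples X Xs -> 0 <= t <= rate b gamma / 2 -> 0 <= r -> 0 <= y ->
  measurable B ->
  (forall w, B w -> (y%:E <= \int[leb]_(s in ~` `[(- r)%R, r[)
     `|ecdf n_gt0 (fun i => Xs i w) s - rcdf X s|%:E)%E) ->
  (P B <= (2 * expR (n%:R * (mgf_const b gamma top * t ^+ 2) -
                     n%:R * t * y / weight_mass r))%:E)%E.
Proof.
move=> HX Xiid t01 r0 y0 mB HB.
have /andP[t0 _] := t01.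
set M := weight_mass r; set C := mgf_const b gamma top.
have M0 : 0 < M by rewrite /M /weight_mass !mulr_gt0// ?invr_gt0 ?subr_gt0// powR_gt0 ?ltr_pwDl.
pose D : set R := ~` `[(- r)%R, r[.
have mD : measurable D by exact: measurableC.
(* The weight in the exponent [yy] cancels the inverse weight in [h]: on [D], [h * yy] is [n t]
   times the deviation, so its integral is [n t] times the outer area. *)
pose h (s : R) : R := \1_D s * (weight b s)^-1.
pose dev w (s : R) : R := `|ecdf n_gt0 (fun i => Xs i w) s - rcdf X s|.
pose yy w (s : R) : R := n%:R * t * weight b s * dev w s.
have v0 s : 0 < weight b s by exact: weight_gt0.
have h0 s : 0 <= h s by rewrite mulr_ge0// invr_ge0 ltW.
have mh : measurable_fun [set: R] h.
  apply: measurable_funM => //.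
  exact: continuous_measurable_fun (continuous_weightV b).
have hM : (\int[leb]_s (h s)%:E = M%:E)%E.
  rewrite -[RHS](integral_weightV_out _ b1 _ r0) [RHS]integral_mkcond.
  apply: eq_integral => s _; rewrite /h patchE -/D indicE.
  by case: (s \in D); rewrite ?mul1r ?mul0r.
have mdev2 : measurable_fun [set: T * measurableTypeR R] (fun z => dev z.1 z.2).
  apply: measurableT_comp => //; apply: measurable_funB.
    apply: measurable_funM => //; apply: measurable_sum => i.
    apply: measurable_natr_bool; apply: measurable_fun_ler => //.
    exact: measurableT_comp.
  by apply: measurableT_comp => //; exact: measurable_CDF.
have mdevR w : measurable_fun [set: R] (dev w).
  by apply: measurableT_comp => //; apply: measurable_funB; exact: measurable_CDF.
have mdevT s : measurable_fun [set: T] (dev^~ s).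
  apply: measurableT_comp => //; apply: measurable_funB => //.
  apply: measurable_funM => //; apply: measurable_sum => i.
  by apply: measurable_natr_bool; exact: measurable_fun_ler.
have mv : measurable_fun [set: R] (weight b) by exact: measurable_weight.
have mf2 : measurable_fun [set: T * measurableTypeR R]
    (fun z => (h z.2 * expR (yy z.1 z.2))%:E).
  apply/measurable_EFinP; apply: measurable_funM; first exact: measurableT_comp.
  apply: measurableT_comp => //; apply: measurable_funM => //.
  by apply: measurable_funM => //; exact: measurableT_comp.
have myy w : measurable_fun [set: R] (yy w).
  by apply: measurable_funM => //; exact: measurable_funM.
pose J w := (\int[leb]_s (h s * expR (yy w s))%:E)%E.
have f20 (z : T * measurableTypeR R) : (0 <= (h z.2 * expR (yy z.1 z.2))%:E)%E.
  by rewrite lee_fin mulr_ge0// expR_ge0.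
have mJ : measurable_fun setT J := measurable_fun_fubini_tonelli_F _ mf2 f20.
have J0 w : (0 <= J w)%E.
  by apply: integral_ge0 => s _; rewrite lee_fin mulr_ge0// expR_ge0.
(* On [B], a lower bound for the mean of [yy w] under [h] normalized by its mass [M]. *)
pose a := n%:R * t * y / M.
have a0 : 0 <= a by rewrite !mulr_ge0// invr_ge0 ltW.
have JB w : B w -> ((M * expR a)%:E <= J w)%E.
  move=> Bw; apply: (@jensen_expR _ _ _ leb h (yy w) M a mh (myy w) h0 _ a0 hM).
  - by move=> s; rewrite /yy; apply: mulr_ge0; [apply: mulr_ge0; [exact: mulr_ge0|exact: ltW]|exact: normr_ge0].
  - rewrite /a divfK ?gt_eqF//.
    apply: (@le_trans _ _ ((n%:R * t)%:E * \int[leb]_(s in D) (dev w s)%:E)%E).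
      by rewrite EFinM lee_wpmul2l ?lee_fin ?mulr_ge0//; exact: HB.
    rewrite -ge0_integralZl//; last 3 first.
    + by apply: measurable_funTS; apply/measurable_EFinP; exact: mdevR.
    + by move=> s _; exact: normr_ge0.
    + by rewrite lee_fin mulr_ge0.
    rewrite [X in (X <= _)%E]integral_mkcond le_eqVlt; apply/orP; left; apply/eqP.
    apply: eq_integral => s _; rewrite patchE /h indicE; case: (s \in D).
      by rewrite -EFinM mul1r /yy; congr EFin; field; rewrite gt_eqF.
    by rewrite !mul0r.
have Me0 : 0 < M * expR a by rewrite mulr_gt0// expR_gt0.
have Markov : ((M * expR a)%:E * P B <= \int[P]_w J w)%E.
  have -> : P B = (\int[P]_w (\1_B w)%:E)%E by rewrite integral_indic// setIT.
  rewrite -ge0_integralZl//; last 2 first.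
  - exact/measurable_EFinP/measurable_indic.
  - by rewrite lee_fin ltW.
  apply: ge0_le_integral => //.
  - by move=> w _; rewrite -EFinM lee_fin mulr_ge0// ltW.
  - by apply: measurable_funeM; exact/measurable_EFinP/measurable_indic.
  - move=> w _; rewrite indicE; have [|_] := boolP (w \in B).
      by rewrite inE => Bw; rewrite mule1; exact: JB.
    by rewrite mule0.
(* After the exchange of integrals the moment bound is uniform in [s], so integrating [h]
   contributes only [M], which cancels the [M] from Markov's inequality. *)
have EJ : (\int[P]_w J w <= (M * (2 * expR (n%:R * (C * t ^+ 2))))%:E)%E.
  rewrite /J (@fubini_tonelli _ _ _ _ _ P leb (fun z : T * measurableTypeR R =>
    (h z.2 * expR (yy z.1 z.2))%:E))//=.
  apply: (@le_trans _ _ (\int[leb]_s ((2 * expR (n%:R * (C * t ^+ 2)))%:E * (h s)%:E))%E).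
    have mfs s : measurable_fun [set: T] (fun w => (expR (yy w s))%:E).
      apply/measurable_EFinP; apply: measurableT_comp => //; exact: measurable_funM.
    have Es s : (\int[P]_w (h s * expR (yy w s))%:E =
        (h s)%:E * \int[P]_w (expR (yy w s))%:E)%E.
      by rewrite -ge0_integralZl// lee_fin.
    apply: ge0_le_integral => //.
    - by move=> s _; apply: integral_ge0 => w _; rewrite lee_fin mulr_ge0// expR_ge0.
    - exact: (measurable_fun_fubini_tonelli_G (m1 := P) _ mf2 f20).
    - by apply: measurable_funeM; exact/measurable_EFinP.
    - move=> s _; rewrite Es muleC lee_wpmul2r ?lee_fin//.
      exact: mgf_weighted_deviation.
  rewrite ge0_integralZl//=.
  - by rewrite hM -EFinM mulrC.
  - exact/measurable_EFinP.
  - by move=> s _; rewrite lee_fin.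
have := le_trans Markov EJ.
rewrite muleC -lee_pdivlMr// => /le_trans; apply.
rewrite -EFinM lee_fin -/a expRD expRN.
rewrite le_eqVlt; apply/orP; left; apply/eqP.
by field; rewrite !gt_eqF// expR_gt0.
Qed.
End area_tail.

(** CDFs take values in [[0, 1]], so an interval of length [2 * r] carries area at most [2 * r]. *)
Lemma W1_area_tail_ge {R : realType} (F G : CDF R) (r x : R) : 0 <= r ->
  (x%:E <= W1_area F G)%E ->
  ((x - 2 * r)%:E <=
   \int[@lebesgue_measure R]_(s in ~` `[(- r)%R, r[) `|F s - G s|%:E)%E.
Proof.
move=> r0; set D : set R := `[(- r)%R, r[%classic.
have mD : measurable D by exact: measurable_itv.
have mFG : measurable_fun [set: R] (fun s => (`|F s - G s|)%:E : \bar R).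
  apply/measurable_EFinP; apply: measurableT_comp => //.
  by apply: measurable_funB; exact: measurable_CDF.
rewrite /W1_area -(setUv D) ge0_integral_setU//; last 3 first.
- exact: measurableC.
- by rewrite setUv.
- by apply/disj_setPS => s [].
move=> hx.
have hD : (\int[@lebesgue_measure R]_(s in D) `|F s - G s|%:E <= (2 * r)%:E)%E.
  apply: (@le_trans _ _ (\int[@lebesgue_measure R]_(s in D) (cst 1%E s))%E).
    apply: ge0_le_integral => //; first exact: measurable_funTS.
    move=> s _; rewrite lee_fin.
    have /andP[? ?] := CDF_itv01 F s; have /andP[? ?] := CDF_itv01 G s.
    by rewrite ler_norml; apply/andP; split; lra.
  rewrite integral_cst// mul1e /D/= lebesgue_measure_itv/= lte_fin.
  by case: ifP => _; [rewrite -EFinD lee_fin; lra|rewrite lee_fin mulr_ge0].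
rewrite EFinB leeBlDr//; apply: (le_trans hx).
by rewrite addeC leeD2l.
Qed.

(** * Choice of the constants and the two regimes of [eps] *)

Theorem theorem25 (R : realType) (beta gamma top : R)
    (hbeta : 1 < beta) (hgamma : 0 < gamma) (htop : 0 < top) :
  exists c1 c2 c3 : R, [/\ 0 < c1, 0 < c2, 0 < c3 &
    forall (d : measure_display) (T : measurableType d) (P : probability T R)
      (X : {RV P >-> R}) (rho : CDF R -> R) (L kappa : R),
      ('E_P[fun w => expR (gamma * `|X w| `^ beta)] < top%:E)%E ->
      type_T1 rho L kappa ->
      forall (n : nat) (n_gt0 : (0 < n)%N) (Xs : 'I_n -> {RV P >-> R})
        (eps : R),
        iid_samples X Xs -> 0 < eps ->
        (P [set w | (eps < `|rho (ecdf n_gt0 (fun i => Xs i w)) -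
                             rho (rcdf X)|)%R] <=
         (c1 * (expR (- (c2 * n%:R * (eps / L) `^ (2 / kappa)))
                  * (eps <= L)%R%:R
              + expR (- (c3 * n%:R * (eps / L) `^ (beta / kappa)))
                  * (L < eps)%R%:R))%R%:E)%E].
Proof.
pose M := 2 * (beta - 1)^-1; pose C := mgf_const beta gamma top.
have b10 : 0 < beta - 1 by rewrite subr_gt0.
have M0 : 0 < M by rewrite mulr_gt0// invr_gt0.
have C0 : 0 < C by exact: mgf_const_gt0.
have r0 : 0 < rate beta gamma by exact: rate_gt0.
(* The first bound makes the moment estimate applicable; the second keeps the quadratic term [C a^2]
   below a quarter of [a / M]. *)
pose a := Num.min (rate beta gamma / 2) (4 * M * C)^-1.
have a0 : 0 < a.
  rewrite /a lt_min; apply/andP; split; first by rewrite divr_gt0.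
  by rewrite invr_gt0 mulr_gt0// mulr_gt0.
have a1 : a <= rate beta gamma / 2 by rewrite /a ge_min lexx.
have aC : C * a <= (4 * M)^-1.
  have -> : (4 * M)^-1 = C * (4 * M * C)^-1 by field; rewrite !gt_eqF.
  by rewrite ler_pM2l// /a ge_min lexx orbT.
exists 2, (a / (2 * M)), (a * 4 `^ (- beta) / M); split.
- by [].
- by rewrite divr_gt0// mulr_gt0.
- by rewrite divr_gt0// mulr_gt0// powR_gt0.
move=> d T P X rho L kappa HX T1 n n_gt0 Xs eps Xiid e0.
have [L0 /andP[k0 _] _] := T1.
have mB := measurable_T1_deviation _ _ rho L kappa (rho (rcdf X)) eps n n_gt0 Xs T1.
set B := [set w | _] in mB *.
pose x := (eps / L) `^ kappa^-1.
have eL0 : 0 < eps / L by rewrite divr_gt0.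
have ki0 : 0 <= kappa^-1 by rewrite invr_ge0 ltW.
have x0 : 0 < x by rewrite powR_gt0.
have xpow (p : R) : (eps / L) `^ (p / kappa) = x `^ p by rewrite (mulrC p) powRrM.
have HB w : B w -> (x%:E <= W1_area (ecdf n_gt0 (fun i => Xs i w)) (rcdf X))%E.
  exact: T1_deviation_area_le.
have n0 : 0 <= n%:R :> R by [].
rewrite !xpow; case: (leP eps L) => [eL|Le]; rewrite ?mulr0 ?mulr1 ?addr0 ?add0r.
  (* This keeps [t = a * x] within [rate / 2]. *)
  have x1 : x <= 1.
    have := @ge0_ler_powR _ _ ki0 (eps / L) 1.
    rewrite powR1 !nnegrE ler01 (ltW eL0); apply => //.
    by rewrite ler_pdivrMr// mul1r.
  apply: le_trans (_ : _ <= (2 * expR (n%:R * (C * (a * x) ^+ 2) -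
    n%:R * (a * x) * x / weight_mass beta 0))%:E)%E _.
    apply: (area_tail _ _ _ _ _ _ hbeta hgamma htop _ _ n_gt0 _ _ _ _ _ HX Xiid _ (lexx 0) (ltW x0) mB _).
      apply/andP; split; first by rewrite mulr_ge0 ?ltW.
      by apply: le_trans a1; rewrite ler_piMr// ltW.
    move=> w /HB /(W1_area_tail_ge _ _ _ _ (lexx 0)).
    by rewrite mulr0 subr0.
  rewrite lee_fin ler_pM2l// ler_expR.
  have -> : weight_mass beta 0 = M by rewrite /weight_mass addr0 powR1 mulr1.
  rewrite (powR_mulrn 2 (ltW x0)).
  pose w := n%:R * a * x ^+ 2.
  have w0 : 0 <= w := mulr_ge0 (mulr_ge0 n0 (ltW a0)) (sqr_ge0 x).
  (* The positive term is at most a quarter of the negative one, so at least half of the latter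
     survives, as [c2 = a / (2 M)] requires. *)
  have h : C * a * w <= (4 * M)^-1 * w by rewrite ler_wpM2r.
  have z0 : 0 <= M^-1 * w by rewrite mulr_ge0// invr_ge0 ltW.
  have -> : n%:R * (C * (a * x) ^+ 2) - n%:R * (a * x) * x / M =
            C * a * w - M^-1 * w by rewrite /w; field; rewrite gt_eqF.
  have -> : a / (2 * M) * n%:R * x ^+ 2 = 2^-1 * (M^-1 * w).
    by rewrite /w; field; rewrite gt_eqF.
  rewrite invfM -(mulrA 4^-1) in h.
  by move: (C * a * w) (M^-1 * w) h z0 => u v; lra.
have x1 : 1 < x.
  have := @gt0_ltr_powR _ kappa^-1 _ 1 (eps / L).
  rewrite invr_gt0 powR1 !nnegrE ler01 (ltW eL0); apply => //.
  by rewrite ltr_pdivlMr// mul1r.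
have x40 : 0 <= x / 4 by rewrite divr_ge0// ltW.
have x20 : 0 <= x / 2 by rewrite divr_ge0// ltW.
apply: le_trans (_ : _ <= (2 * expR (n%:R * (C * a ^+ 2) -
    n%:R * a * (x / 2) / weight_mass beta (x / 4)))%:E)%E _.
  apply: (area_tail _ _ _ _ _ _ hbeta hgamma htop _ _ n_gt0 _ _ _ _ _ HX Xiid _ x40 x20 mB _).
    by rewrite (ltW a0).
  move=> w /HB /(W1_area_tail_ge _ _ _ _ x40).
  by have -> : x - 2 * (x / 4) = x / 2 by lra.
rewrite lee_fin ler_pM2l// ler_expR /weight_mass -/M -[1 - beta]opprB (powRN (1 + x / 4)).
(* The mass of the inverse weight outside [[-x/4, x/4[] is [M / g], so dividing by it gains the
   factor [g]. *)
set g := (1 + x / 4) `^ (beta - 1).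
have g1 : 1 <= g.
  have := @ge0_ler_powR _ (beta - 1) (ltW b10) 1 (1 + x / 4).
  by rewrite powR1; apply => //; rewrite ?nnegrE ?lerDl ?addr_ge0.
(* Here the power [beta] appears, since [g >= (x / 4)^(beta - 1)]; it also explains the [4^(- beta)]
   in [c3]. *)
have gx : 4 `^ (- beta) * x `^ beta <= x / 4 * g.
  have -> : 4 `^ (- beta) * x `^ beta = x / 4 * (x / 4) `^ (beta - 1).
    have xb : x / 4 * (x / 4) `^ (beta - 1) = (x / 4) `^ beta.
      rewrite -[X in X * _ = _](powRr1 x40) -powRD; last first.
        by apply/implyP => _; rewrite gt_eqF// divr_gt0.
      by rewrite subrKC.
    rewrite xb powRM ?(ltW x0)// mulrC; congr (_ * _).
    by rewrite -powR_inv1// -powRrM mulN1r.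
  rewrite ler_wpM2l//; have := @ge0_ler_powR _ _ (ltW b10) (x / 4) (1 + x / 4).
  by rewrite !nnegrE x40 addr_ge0// lerDr; exact.
have C2 : C * a ^+ 2 <= a * (x / 4 * g) / M.
  have : a * (C * a) <= a * (4 * M)^-1 by rewrite ler_pM2l.
  have -> : a * (C * a) = C * a ^+ 2 by ring.
  move=> /le_trans; apply; rewrite -mulrA ler_pM2l// invfM ler_pM2r ?invr_gt0//.
  have := ler_wpM2l x40 g1; lra.
(* Of the two equal halves of the negative term, one absorbs the quadratic term by [C2] and the
   other yields [x^beta] by [gx]. *)
have -> : n%:R * a * (x / 2) / (M * g^-1) = 2 * (n%:R * (a * (x / 4 * g) / M)).
  by field; rewrite !gt_eqF// (lt_le_trans ltr01 g1).
have h1 : n%:R * (C * a ^+ 2) <= n%:R * (a * (x / 4 * g) / M) by rewrite ler_wpM2l.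
have h2 : a * 4 `^ (- beta) / M * n%:R * x `^ beta <= n%:R * (a * (x / 4 * g) / M).
  have -> : a * 4 `^ (- beta) / M * n%:R * x `^ beta =
            n%:R * (a * (4 `^ (- beta) * x `^ beta) / M) by ring.
  by rewrite ler_wpM2l// ler_pM2r ?invr_gt0// ler_pM2l.
lra.
Qed.
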